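(* Let $X$ be a set, let $m\ge 2$ be an integer, and let $S=\{g_1,\ldots,g_m\}\subseteq\Omega_m(X)$ be a set of orthogonal $m$-ary operations on $X$. Then the map \[\mathcal{Q}_m(X)\to \mathrm{Ort}(S),\qquad f\mapsto \odot_f(g_1,\ldots,g_m)\] is (well defined and) a bijection.
   Context: $\Omega_m(X)$ is the set of all $m$-ary operations $X^m\to X$. $\mathcal{Q}_m(X)\subset\Omega_m(X)$ is the set of $m$-ary quasigroup operations: $f\in\mathcal{Q}_m(X)$ iff for each $1\le i\le m$, all $(a_1,\ldots,a_{i-1},a_{i+1},\ldots,a_m)\in X^{m-1}$ and all $b\in X$, there is a unique $a_i\in X$ with $f(a_1,\ldots,a_m)=b$. For $f,g_1,\ldots,g_m\in\Omega_m(X)$, the operation $\odot_f(g_1,\ldots,g_m)\in\Omega_m(X)$ is defined by $\odot_f(g_1,\ldots,g_m)(\overline a):=f(g_1(\overline a),\ldots,g_m(\overline a))$ for all $\overline a\in X^m$. Operations $g_1,\ldots,g_m\in\Omega_m(X)$ form a set of orthogonal $m$-ary operations if the map $X^m\to X^m$, $\overline a\mapsto(g_1(\overline a),\ldots,g_m(\overline a))$ is a bijection. (This does not depend on the order of the $g_i$.) For $S=\{g_1,\ldots,g_m\}$, $\mathrm{Ort}(S)$ is the set of all $g\in\Omega_m(X)$ such that for every $1\le i\le m$, replacing $g_i$ by $g$ in the list $g_1,\ldots,g_m$ gives a set of orthogonal operations, i.e. the map $\overline a\mapsto (g_1(\overline a),\ldots,g_{i-1}(\overline a),g(\overline a),g_{i+1}(\overline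 a),\ldots,g_m(\overline a))$ is a bijection of $X^m$. *)

(* Defs.v *)
From mathcomp Require Import all_boot.
From mathcomp Require Import boolp classical_sets functions.

Set Implicit Arguments.
Unset Strict Implicit.
Unset Printing Implicit Defensive.

Local Open Scope classical_set_scope.

(* X ^ m is MathComp's {ffun 'I_m -> X}; coordinates are numbered from 0. *)
Definition operation (m : nat) (X : Type) : Type := (X ^ m)%type -> X.

(* (a_1, ..., a_{i-1}, x, a_{i+1}, ..., a_m): the m - 1 entries of a fill, in
   order, the coordinates other than i. *)
Definition insert_coord (m : nat) (X : Type) (i : 'I_m) (a : (X ^ m.-1)%type)
    (x : X) : (X ^ m)%type :=
  [ffun j => if unlift i j is Some k then a k else x].

Definition quasigroup_ops (m : nat) (X : Type) : set (operation m X) :=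
  [set f | forall (i : 'I_m) (a : (X ^ m.-1)%type) (b : X),
    exists! x : X, f (insert_coord i a x) = b].
Arguments quasigroup_ops : clear implicits.

Definition odot (m : nat) (X : Type) (f : operation m X)
    (g : 'I_m -> operation m X) : operation m X :=
  fun a => f [ffun i => g i a].

Definition orthogonal_ops (m : nat) (X : Type) (g : 'I_m -> operation m X) :
    Prop :=
  bijective (fun a : (X ^ m)%type => [ffun i => g i a] : (X ^ m)%type).

Definition replace_op (m : nat) (X : Type) (g : 'I_m -> operation m X)
    (i : 'I_m) (h : operation m X) : 'I_m -> operation m X :=
  fun j => if j == i then h else g j.

(* A set {g_1, ..., g_m} of operations is represented by the indexed family g,
   as the g_i need not be distinct when X has at most one element. *)
Definition Ort (m : nat) (X : Type) (g : 'I_m -> operation m X) :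
    set (operation m X) :=
  [set h | forall i : 'I_m, orthogonal_ops (replace_op g i h)].

(* Main.v *)
Require Import Defs.
From mathcomp Require Import all_boot.
From mathcomp Require Import boolp classical_sets functions.

Set Implicit Arguments.
Unset Strict Implicit.
Unset Printing Implicit Defensive.

(** Let [G] be the bijection [a |-> (g_1 a, ..., g_m a)] of [X ^ m], so that
    [odot f g = f \o G], and let [P_i] be the map replacing the [i]-th entry of
    [a] by [f a].  Replacing [g_i] by [odot f g] turns [G] into [P_i \o G].
    Hence [odot f g] is in [Ort g] iff every [P_i] is bijective, which says
    exactly that [f] is a quasigroup operation; the inverse of the map
    [f |-> odot f g] is composition with the inverse of [G]. *)

(** [bijective] asks for a two-sided inverse function, whereas the quasigroup condition speaks of
    unique solutions; choosing a solution for each [b] supplies the inverse. *)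
Lemma bijective_exists_unique (A B : Type) (F : A -> B) :
  bijective F <-> forall b, exists! a, F a = b.
Proof.
split=> [[F' FK F'K] b | F_uniq].
  by exists (F' b); split=> [|a <-]; rewrite ?F'K ?FK.
have F_surj b : exists a, F a = b by have [a [Fa _]] := F_uniq b; exists a.
have [F' F'K] := boolp.choice F_surj.
exists F' => // a; have [a' [_ uniq_a']] := F_uniq (F a).
by rewrite -(uniq_a' (F' (F a))) ?F'K //; apply: uniq_a'.
Qed.

Section CoordinateReplacement.
Variables (m : nat) (X : Type).
Implicit Types (i : 'I_m) (a : (X ^ m)%type) (f : operation m X).

Lemma insert_coord_at i (r : (X ^ m.-1)%type) x : insert_coord i r x i = x.
Proof. by rewrite ffunE unlift_none. Qed.

Lemma insert_coord_eta i a :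
  insert_coord i [ffun k => a (lift i k)] (a i) = a.
Proof.
by apply/ffunP => j; rewrite ffunE; case: unliftP => [k|] ->; rewrite ?ffunE.
Qed.

Definition replace_coord f i a : (X ^ m)%type :=
  [ffun j => if j == i then f a else a j].

(** Only the [i]-th entry changes, so a preimage of [insert_coord i r c] keeps the other entries [r]
    and is determined by its own [i]-th entry, a solution [x] of [f (insert_coord i r x) = c]. *)
Lemma replace_coord_eq_insert f i a (r : (X ^ m.-1)%type) c :
  replace_coord f i a = insert_coord i r c <->
  a = insert_coord i r (a i) /\ f a = c.
Proof.
split=> [eq_a | [eq_a fa]]; last first.
  apply/ffunP => j; rewrite ffunE fa.
  case: eqVneq => [->|ne_ji]; first by rewrite insert_coord_at.
  by rewrite eq_a !ffunE; case: unliftP ne_ji => // ->; rewrite eqxx.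
split; last by move/ffunP/(_ i): eq_a; rewrite insert_coord_at ffunE eqxx.
apply/ffunP => j; move/ffunP/(_ j): eq_a; rewrite !ffunE.
by case: unliftP => [k|] -> //; rewrite eq_sym (negPf (neq_lift i k)).
Qed.

Lemma quasigroup_replace_coord f :
  quasigroup_ops m X f <-> forall i, bijective (replace_coord f i).
Proof.
split=> [qf i | bij_f i r c].
  (* Every target point has the form [insert_coord i r c], so its preimages correspond to the
     solutions given by [qf]. *)
  apply/bijective_exists_unique => b; rewrite -(insert_coord_eta i b).
  move: [ffun k => b (lift i k)] (b i) => r c.
  have [x [fx uniq_x]] := qf i r c; exists (insert_coord i r x); split.
    by apply/replace_coord_eq_insert; rewrite insert_coord_at.
  move=> a /replace_coord_eq_insert[eq_a fa].
  by rewrite [RHS]eq_a (uniq_x (a i)) // -eq_a.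
have /bijective_exists_unique/(_ (insert_coord i r c)) := bij_f i.
case=> a [/replace_coord_eq_insert[eq_a fa] uniq_a].
exists (a i); split=> [|x fx]; first by rewrite -eq_a.
rewrite (uniq_a (insert_coord i r x)) ?insert_coord_at //.
by apply/replace_coord_eq_insert; rewrite insert_coord_at.
Qed.

Lemma Ort_odot (g : 'I_m -> operation m X) f :
  orthogonal_ops g -> Ort g (odot f g) <-> quasigroup_ops m X f.
Proof.
move=> bij_g; rewrite quasigroup_replace_coord.
suff bijE i : orthogonal_ops (replace_op g i (odot f g)) <->
              bijective (replace_coord f i).
  by split=> H i; apply/bijE.
rewrite /orthogonal_ops.
set G := fun a : (X ^ m)%type => [ffun j => g j a] : (X ^ m)%type.
have -> : (fun a => [ffun j => replace_op g i (odot f g) j a])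
          = replace_coord f i \o G.
  apply/funext => a; apply/ffunP => j; rewrite /= !ffunE /replace_op.
  by case: eqP.
split=> [bij_fG | bij_f]; last exact: bij_comp.
have [G' GK G'K] := bij_g.
(* Composing on the right with [G'] cancels [G]. *)
apply: (eq_bij (bij_comp bij_fG (Bijective G'K GK))) => a.
by congr replace_coord; apply: G'K.
Qed.

End CoordinateReplacement.

Theorem theorem4p3 (X : Type) (m : nat) (hm : 2 <= m)
    (g : 'I_m -> operation m X) (hg : orthogonal_ops g) :
  set_bij (quasigroup_ops m X) (Ort g) (fun f => odot f g).
Proof.
have [G' GK G'K] := hg; split=> [f qf | f1 f2 _ _ eq_f | h hOrt].
- exact/Ort_odot.
(* Each [a] is the tuple of values of [g] at [G' a], so [eq_f] evaluated at [G' a] compares [f1] and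
   [f2] at [a]. *)
- by apply/funext => a; rewrite -(G'K a); apply: (congr1 (@^~ (G' a)) eq_f).
- have odot_h : odot (h \o G') g = h.
    by apply/funext => a; rewrite /odot /= GK.
  by exists (h \o G') => //; apply/(Ort_odot _ hg); rewrite odot_h.
Qed.
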